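(* Let $G=(V,E)$ be a graph and let $k\in\mathbb{Z}$ with $k\ge 3$ and $k\,(\omega(G)+|V|)$ odd. Then $G$ is not critical. However, $G$ is weakly critical if and only if $$k\,\Psi(G)+\left\lfloor\frac{k}{2}\right\rfloor=\Psi(\nabla^k G).$$
   Context: All graphs are finite and simple; $|G|=|V|$ denotes the number of vertices of $G$. A coloring of a graph $G=(V,E)$ is a surjective map $\ell:V\to C$ onto a finite set $C$ of colors; it need not be proper. It is pseudocomplete if for any two distinct colors $i,j\in C$ there is an edge $uv\in E$ with $\{\ell(u),\ell(v)\}=\{i,j\}$. The pseudoachromatic number $\Psi(G)$ is the greatest number of colors used in a pseudocomplete coloring of $G$ (so $\Psi$ of the graph with no vertices is $0$). $\omega(G)$ is the clique number. $\nabla^k G$ is the join of $k$ copies of $G$: the disjoint union of $k$ copies of $G$ together with all edges between vertices in different copies. For an integer $0\le j\le |G|$, $\operatorname{mpd}_G(j)=\min\{\Psi(G)-\Psi(G\setminus X) : X\subseteq V,\ |X|=j\}$, where $G\setminus X$ is the subgraph induced on $V\setminus X$. $G$ is critical if $\operatorname{mpd}_G(j)\ge\lceil j/2\rceil$ for all $0\le j\le |G|$, and weakly critical if $\operatorname{mpd}_G(j)\ge\lfloor j/2\rfloor$ for all $0\le j\le |G|$. *)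

(* Defs.v *)
From HB Require Import structures.
From mathcomp Require Import all_boot.

Set Implicit Arguments.
Unset Strict Implicit.
Unset Printing Implicit Defensive.

Record sgraph := SGraph {
  vertex :> finType;
  edge : rel vertex;
  edge_sym : symmetric edge;
  edge_irrefl : irreflexive edge }.

Section Invariants.
Variable G : sgraph.

Definition clique (K : {set G}) : bool :=
  [forall u in K, forall v in K, (u != v) ==> edge u v].

Definition clique_number : nat := \max_(K : {set G} | clique K) #|K|.

Definition coloring (C : finType) (l : G -> C) : bool :=
  [forall c, exists v, l v == c].

Definition pseudocomplete (C : finType) (l : G -> C) : bool :=
  [forall i, forall j, (i != j) ==>
    [exists u, exists v, edge u v && ([set l u; l v] == [set i; j])]].

(* A coloring uses at most #|G| colors and the color set matters only up to
   bijection, so color sets 'I_n with n <= #|G| suffice: see [Psi_upper] and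
   [Psi_attained]. *)
Definition Psi : nat :=
  \max_(n < #|G|.+1 |
         [exists l : {ffun G -> 'I_n}, coloring l && pseudocomplete l]) n.

Fact deletion_sym (X : {set G}) :
  symmetric (fun u v : {x : G | x \notin X} => edge (val u) (val v)).
Proof. by move=> u v; apply: edge_sym. Qed.

Fact deletion_irrefl (X : {set G}) :
  irreflexive (fun u v : {x : G | x \notin X} => edge (val u) (val v)).
Proof. by move=> u; apply: edge_irrefl. Qed.

Definition deletion (X : {set G}) : sgraph :=
  SGraph (@deletion_sym X) (@deletion_irrefl X).

Definition join_edge (k : nat) : rel ('I_k * G) :=
  fun p q => (p.1 != q.1) || edge p.2 q.2.

Fact join_edge_sym k : symmetric (@join_edge k).
Proof. by move=> p q; rewrite /join_edge eq_sym edge_sym. Qed.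

Fact join_edge_irrefl k : irreflexive (@join_edge k).
Proof. by move=> p; rewrite /join_edge eqxx edge_irrefl. Qed.

Definition join_copies (k : nat) : sgraph :=
  SGraph (@join_edge_sym k) (@join_edge_irrefl k).

End Invariants.

(* The subtraction is never truncated ([Psi_deletion]), and the neutral
   element [Psi G] bounds every term from above, so for j <= #|G| it does not
   affect the minimum ([mpd_attained]). *)
Definition mpd (G : sgraph) (j : nat) : nat :=
  \big[minn/Psi G]_(X : {set G} | #|X| == j) (Psi G - Psi (deletion X)).

Definition critical (G : sgraph) : Prop :=
  forall j, j <= #|G| -> uphalf j <= mpd G j.

Definition weakly_critical (G : sgraph) : Prop :=
  forall j, j <= #|G| -> j./2 <= mpd G j.

Lemma coloring_card (G : sgraph) (C : finType) (l : G -> C) :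
  coloring l -> #|C| <= #|G|.
Proof.
move=> /forallP sl; rewrite -(size_codom l) -[#|C|]/#|{: C}|.
apply: leq_trans (card_size (codom l)); apply: subset_leq_card.
by apply/subsetP=> c _; have /existsP[v /eqP<-] := sl c; apply: codom_f.
Qed.

Lemma Psi_upper (G : sgraph) (C : finType) (l : G -> C) :
  coloring l -> pseudocomplete l -> #|C| <= Psi G.
Proof.
move=> cl pl; have lt : #|C| < #|G|.+1 by rewrite ltnS (coloring_card cl).
rewrite /Psi; apply: (@leq_bigmax_cond _ _ _ (Ordinal lt)) => /=.
apply/existsP; exists [ffun v => enum_rank (l v)]; apply/andP; split.
  apply/forallP=> c; have /existsP[v /eqP e] := forallP cl (enum_val c).
  by apply/existsP; exists v; rewrite ffunE e enum_valK.
apply/forallP=> i; apply/forallP=> j; apply/implyP=> ij.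
have := forallP (forallP pl (enum_val i)) (enum_val j).
rewrite (inj_eq enum_val_inj) ij => /existsP[u /existsP[v /andP[uv /eqP e]]].
apply/existsP; exists u; apply/existsP; exists v; rewrite uv !ffunE /=.
have := congr1 (fun A : {set C} => enum_rank @: A) e.
by rewrite !imsetU1 !imset_set1 !enum_valK => ->.
Qed.

Lemma Psi_attained (G : sgraph) :
  exists2 l : G -> 'I_(Psi G), coloring l & pseudocomplete l.
Proof.
pose P (n : 'I_#|G|.+1) :=
  [exists l : {ffun G -> 'I_n}, coloring l && pseudocomplete l].
have [n0 Pn0] : exists n, P n.
  have [G0|/card_gt0P[x _]] := posnP #|G|.
    have e0 (v : G) : 'I_0 by have := fintype0 v; rewrite G0; case.
    exists ord0; apply/existsP; exists [ffun v => e0 v]; apply/andP.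
    by split; apply/forallP=> -[].
  have lt : 1 < #|G|.+1 by rewrite ltnS; apply/card_gt0P; exists x.
  exists (Ordinal lt); apply/existsP.
  exists [ffun=> ord0]; apply/andP; split; apply/forallP=> c.
    by apply/existsP; exists x; rewrite ffunE [c]ord1.
  by apply/forallP=> d; rewrite [c]ord1 [d]ord1 eqxx.
rewrite /Psi (bigmax_eq_arg n0) //; case: arg_maxnP => // n.
by move=> /existsP[l /andP[cl pl]] _; exists l.
Qed.

Lemma Psi_deletion (G : sgraph) (X : {set G}) : Psi (deletion X) <= Psi G.
Proof.
have [l cl pl] := Psi_attained (deletion X).
have [->//|Psi_gt0] := posnP (Psi (deletion X)).
pose l' (v : G) := if insub v is Some w then l w else Ordinal Psi_gt0.
have l'E w : l' (val w) = l w by rewrite /l' valK.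
rewrite -[leqLHS]card_ord; apply: (@Psi_upper G _ l').
  apply/forallP=> c; have /existsP[v lv] := forallP cl c.
  by apply/existsP; exists (val v); rewrite l'E.
apply/forallP=> i; apply/forallP=> j; apply/implyP=> ij.
have /implyP/(_ ij)/existsP[u /existsP[v uv]] := forallP (forallP pl i) j.
by apply/existsP; exists (val u); apply/existsP; exists (val v); rewrite !l'E.
Qed.

Lemma mpd_le (G : sgraph) (X : {set G}) :
  mpd G #|X| <= Psi G - Psi (deletion X).
Proof.
have : X \in index_enum {set G} by apply: mem_index_enum.
rewrite /mpd; elim: (index_enum _) => // Y r IH; rewrite inE big_cons.
case/predU1P=> [<-|/IH le_r]; first by rewrite eqxx geq_minl.
by case: ifP => // _; apply: leq_trans (geq_minr _ _) le_r.
Qed.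

Lemma mpd_attained (G : sgraph) (j : nat) : j <= #|G| ->
  exists2 X : {set G}, #|X| = j & mpd G j = Psi G - Psi (deletion X).
Proof.
move=> jG; have [X0 X0j] : exists X : {set G}, #|X| == j.
  exists [set x in take j (enum G)]; rewrite cardsE.
  rewrite (card_uniqP _) ?take_uniq ?enum_uniq // size_take -cardE.
  by case: (ltngtP j #|G|) jG => // ->.
case: (@arg_minnP _ X0 (fun X => #|X| == j)
  (fun X : {set G} => Psi G - Psi (deletion X)) X0j) => X Xj minX.
exists X; first exact: (eqP Xj).
apply/eqP; rewrite eqn_leq -{1}(eqP Xj) mpd_le /mpd /=.
by elim/big_rec: _ => [|Y m Yj IH]; rewrite ?leq_subr // leq_min minX.
Qed.

(* Main.v *)
Require Import Defs.
From mathcomp Require Import all_boot zify.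

(** Everything rests on the bound [2 * Psi G <= #|G| + clique_number G]
    ([double_Psi_leq]): in a pseudocomplete coloring the vertices that are alone
    in their color class form a clique, and every other class has at least two
    vertices.

    For joins of at least two copies this bound is attained up to rounding
    ([Psi_join]): [Psi (join_copies G k) = (k * (clique_number G + #|G|))./2].
    A maximum clique is copied [k] times into singleton classes, and the other
    vertices are grouped in pairs meeting two different copies; every
    vertex of the graph is adjacent to some vertex of such a pair.

    If [k * (clique_number G + #|G|)] is odd, the equation in the theorem
    therefore amounts to [2 * Psi G + 1 = clique_number G + #|G|], the largest
    value of [Psi G] that parity allows.  This is also equivalent to weak
    criticality ([weakly_criticalP]).  If [G] is weakly critical, delete all
    vertices outside a maximum clique; conversely, apply the bound to every
    [deletion X].  The same deletion shows that [G] is not critical: its size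
    [#|G| - clique_number G] is odd, so criticality would need
    [2 * Psi G >= #|G| + clique_number G + 1], against the bound. *)

Set Implicit Arguments.
Unset Strict Implicit.
Unset Printing Implicit Defensive.

(** * The bound on the pseudoachromatic number, and criticality *)

Section Graph.
Variable G : sgraph.
Implicit Types (K X : {set G}) (u v : G).

Lemma cliqueP K :
  reflect {in K &, forall u v, u != v -> edge u v} (clique K).
Proof.
apply: (iffP forall_inP) => [cK u v uK vK uv | cK u uK].
  by have /forall_inP/(_ v vK)/implyP := cK u uK; apply.
by apply/forall_inP=> v vK; apply/implyP; apply: cK.
Qed.

Lemma clique_number_max K : clique K -> #|K| <= clique_number G.
Proof. by move=> cK; apply: leq_bigmax_cond. Qed.

Lemma clique_number_attained :
  exists2 K : {set G}, clique K & #|K| = clique_number G.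
Proof.
have [|K cK eK] := @eq_bigmax_cond _ (@clique G) (fun K : {set G} => #|K|).
  apply/card_gt0P; exists set0; apply/cliqueP => u; by rewrite inE.
by exists K.
Qed.

Lemma clique_number_card : clique_number G <= #|G|.
Proof. by have [K _ <-] := clique_number_attained; apply: max_card. Qed.

(** Each color class counted together with its vertices in [K], the set of
    vertices alone in their class, contributes at least 2. *)
Lemma double_Psi_leq : 2 * Psi G <= #|G| + clique_number G.
Proof.
have [l /forallP cl /forallP pl] := Psi_attained G.
pose fiber c := [set x | l x == c]; pose K := [set x | #|fiber (l x)| == 1].
have aloneP u v : u \in K -> l v = l u -> v = u.
  rewrite inE => /cards1P[w fE] luv.
  have : u \in fiber (l u) by rewrite inE.
  have : v \in fiber (l u) by rewrite inE luv.
  by rewrite fE !inE => /eqP-> /eqP->.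
have cK : clique K.
  (* An edge realizing the two colors can only join [u] and [v]. *)
  apply/cliqueP => u v uK vK uv.
  have luv : l u != l v by apply: contraNneq uv => /(aloneP _ _ vK)->.
  have /forallP/(_ (l v)) := pl (l u).
  rewrite luv => /existsP[u' /existsP[v' /andP[uv' /eqP E]]].
  have : l u' \in [set l u; l v] by rewrite -E set21.
  have : l v' \in [set l u; l v] by rewrite -E set22.
  have : l u \in [set l u'; l v'] by rewrite E set21.
  have : l v \in [set l u'; l v'] by rewrite E set22.
  rewrite !inE => h1 h2 /orP[] /eqP h3 /orP[] /eqP h4; move: h1 h2.
  - by rewrite h3 h4 orbb eq_sym (negPf luv).
  - by rewrite -(aloneP _ _ uK h3) -(aloneP _ _ vK h4) edge_sym.
  - by rewrite -(aloneP _ _ uK h4) -(aloneP _ _ vK h3).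
  - by rewrite h3 h4 orbb (negPf luv).
apply: leq_trans (leq_add (leqnn _) (clique_number_max cK)).
rewrite -[#|G|]sum1_card -[#|K|]sum1_card.
rewrite (partition_big l xpredT) //= [X in _ + X](partition_big l xpredT) //=.
rewrite -big_split /= mulnC -[X in X * 2]card_ord -sum_nat_const.
apply: leq_sum => c _; rewrite !sum1_card.
have /existsP[x /eqP lx] := cl c.
have fE : #|[pred i | l i == c]| = #|fiber c| by rewrite cardsE.
have f0 : 0 < #|fiber c| by apply/card_gt0P; exists x; rewrite inE lx.
rewrite [X in X + _]fE.
have [f1|f1] := eqVneq #|fiber c| 1; last by lia.
rewrite f1 add1n ltnS; apply/card_gt0P; exists x.
by rewrite unfold_in /= inE lx f1 !eqxx.
Qed.

Lemma clique_number_deletion X : clique_number (deletion X) <= clique_number G.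
Proof.
apply/bigmax_leqP => Q /forall_inP cQ.
rewrite -(card_imset _ val_inj); apply: clique_number_max; apply/cliqueP.
move=> _ _ /imsetP[u uQ ->] /imsetP[v vQ ->] uv.
by have /forall_inP/(_ v vQ)/implyP := cQ u uQ; apply; apply: contraNneq uv => ->.
Qed.

Lemma card_deletion X : #|deletion X| = #|G| - #|X|.
Proof. by rewrite card_sig -(cardC (mem X)) addKn; apply: eq_card. Qed.

Lemma Psi_deletionC_clique K : clique K -> #|K| <= Psi (deletion (~: K)).
Proof.
move=> /cliqueP cK.
have -> : #|K| = #|deletion (~: K)|.
  by rewrite card_deletion cardsCs.
apply: (@Psi_upper _ _ (fun x => x)).
  by apply/forallP => c; apply/existsP; exists c.
apply/forallP=> i; apply/forallP=> j; apply/implyP=> ij.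
apply/existsP; exists i; apply/existsP; exists j; rewrite eqxx andbT.
have inK (x : deletion (~: K)) : val x \in K by have := valP x; rewrite inE negbK.
exact: cK.
Qed.

Lemma clique_number_Psi : clique_number G <= Psi G.
Proof.
have [K cK <-] := clique_number_attained.
exact: leq_trans (Psi_deletionC_clique cK) (Psi_deletion _).
Qed.

(** Deleting all vertices outside a maximum clique costs few colors. *)
Lemma mpd_clique_number :
  mpd G (#|G| - clique_number G) <= Psi G - clique_number G.
Proof.
have [K cK <-] := clique_number_attained.
have -> : #|G| - #|K| = #|~: K| by rewrite [RHS]cardsCs setCK.
exact: leq_trans (mpd_le _) (leq_sub2l _ (Psi_deletionC_clique cK)).
Qed.

Lemma not_critical : odd (clique_number G + #|G|) -> ~ critical G.
Proof.
move=> od /(_ _ (leq_subr (clique_number G) _)).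
have := mpd_clique_number; have := double_Psi_leq; have := clique_number_card.
lia.
Qed.

End Graph.

Lemma weakly_criticalP (G : sgraph) : odd (clique_number G + #|G|) ->
  weakly_critical G <-> 2 * Psi G + 1 = clique_number G + #|G|.
Proof.
move=> od; split=> [/(_ _ (leq_subr (clique_number G) _))|Psi_eq j jG].
  have := mpd_clique_number G; have := double_Psi_leq G; have := clique_number_card G.
  have := clique_number_Psi G; lia.
have [X Xj ->] := mpd_attained jG.
have := double_Psi_leq (deletion X).
have := clique_number_deletion X; rewrite card_deletion Xj.
lia.
Qed.

(** * The pseudoachromatic number of a join of copies *)

(** Unlike [Psi_upper], the coloring may miss some elements of [C]. *)
Lemma Psi_image (H : sgraph) (C : finType) (l : H -> C) :
  (forall x y, l x != l y ->
     exists u v, [/\ edge u v, l u = l x & l v = l y]) ->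
  #|l @: [set: H]| <= Psi H.
Proof.
move=> adj; pose D := {c | c \in l @: [set: H]}.
have l_in x : l x \in l @: [set: H] by apply: imset_f.
pose l' x : D := Sub (l x) (l_in x).
have l'_onto c : exists x, l' x = c.
  by have /imsetP[x _ e] := valP c; exists x; apply: val_inj.
rewrite -card_sig; apply: (@Psi_upper _ D l').
  by apply/forallP=> c; apply/existsP; have [x /eqP] := l'_onto c; exists x.
apply/forallP=> c; apply/forallP=> d; apply/implyP.
have [[x <-] [y <-]] := (l'_onto c, l'_onto d).
rewrite -val_eqE /= => /adj[u [v [uv eu ev]]].
apply/existsP; exists u; apply/existsP; exists v; rewrite uv /=; apply/eqP.
by congr [set _; _]; apply: val_inj.
Qed.

Section Join.
Variables (G : sgraph) (k : nat).

Lemma clique_number_join :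
  clique_number (join_copies G k) <= k * clique_number G.
Proof.
apply/bigmax_leqP => Q /cliqueP cQ.
rewrite -sum1_card (partition_big (fun x => x.1) xpredT) //=.
rewrite -[X in X * _]card_ord -sum_nat_const; apply: leq_sum => i _.
have cQi : clique [set u | (i, u) \in Q].
  apply/cliqueP => u v; rewrite !inE => uQ vQ uv.
  have : join_edge (i, u) (i, v).
    by apply: cQ => //; rewrite xpair_eqE eqxx.
  by rewrite /join_edge /= eqxx.
apply: leq_trans (clique_number_max cQi).
have iI : injective (pair i : G -> _) by move=> u v [].
rewrite sum1_card -(card_imset _ iI); apply/subset_leq_card/subsetP.
move=> [i' u]; rewrite -topredE /= => /andP[iuQ /eqP e]; move: iuQ.
by rewrite e => iuQ; apply/imsetP; exists u; rewrite // inE.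
Qed.

Section Coloring.
Variable K : {set G}.

(** The vertices outside [K] of all copies are numbered so that consecutive
    ones lie in different copies. *)
Definition join_rank (x : join_copies G k) : nat :=
  index x.2 (enum (~: K)) * k + x.1.

(** Copies of vertices of [K] are alone in their classes; the other vertices
    are paired by consecutive ranks, and if their number is odd the last one
    joins the last pair. *)
Definition join_color (x : join_copies G k) :
    ('I_k * G) + 'I_((k * #|~: K|)./2.-1.+1) :=
  if x.2 \in K then inl x
  else inr (inord (minn (join_rank x)./2 (k * #|~: K|)./2.-1)).

Lemma join_rank_lt x : x.2 \notin K -> join_rank x < k * #|~: K|.
Proof.
move=> xK; have : index x.2 (enum (~: K)) < #|~: K|.
  by rewrite cardE index_mem mem_enum inE.
rewrite mulnC -(leq_pmul2r (leq_ltn_trans (leq0n _) (ltn_ord x.1))) mulSn.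
by apply: leq_trans; rewrite /join_rank addnC ltn_add2r.
Qed.

Lemma join_rank_mod x : join_rank x = x.1 %[mod k].
Proof. by rewrite /join_rank modnMDl. Qed.

Lemma join_rank_onto r : r < k * #|~: K| ->
  exists2 x, x.2 \notin K & join_rank x = r.
Proof.
move=> rlt; have k0 : 0 < k by lia.
have qlt : r %/ k < size (enum (~: K)) by rewrite -cardE ltn_divLR // mulnC.
case E : (enum (~: K)) => [|u0 s]; first by rewrite E in qlt.
exists (Ordinal (ltn_pmod r k0), nth u0 (enum (~: K)) (r %/ k)) => /=.
  by have := mem_nth u0 qlt; rewrite mem_enum inE.
by rewrite /join_rank /= index_uniq ?enum_uniq // -divn_eq.
Qed.

Lemma join_color_rank x y : x.2 \notin K -> y.2 \notin K ->
  minn (join_rank x)./2 (k * #|~: K|)./2.-1 =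
  minn (join_rank y)./2 (k * #|~: K|)./2.-1 -> join_color x = join_color y.
Proof. by rewrite /join_color => /negPf-> /negPf-> ->. Qed.

Lemma join_color_count :
  k * #|K| + (k * #|~: K|)./2 <= #|join_color @: setT|.
Proof.
set M := (k * _)./2.
pose A := [set inl x | x in setX setT K] : {set ('I_k * G) + 'I_M.-1.+1}.
pose B := [set inr q | q in [set q : 'I_M.-1.+1 | q < M]] :
  {set ('I_k * G) + 'I_M.-1.+1}.
have AB0 : [disjoint A & B].
  by apply/pred0P => z; apply/andP => -[/imsetP[p _ ->] /imsetP[]].
have cA : #|A| = k * #|K|.
  by rewrite card_imset ?cardsX ?cardsT ?card_ord // => p q [].
have cB : #|B| = M.
  rewrite card_imset; last by move=> p q [].
  have [M0|M0] := posnP M; first by rewrite M0; apply: eq_card0 => q; rewrite inE.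
  rewrite -[RHS](prednK M0) -[RHS]card_ord; apply: eq_card => q.
  by rewrite !inE; have := ltn_ord q; lia.
have := (leq_card_setU A B).2; rewrite AB0 cA cB => /eqP<-.
apply/subset_leq_card/subsetP => z /setUP[] /imsetP[].
  move=> [i u]; rewrite in_setX => /andP[_ uK] ->.
  by apply/imsetP; exists (i, u); rewrite // /join_color uK.
move=> q; rewrite inE => qM ->.
have [|x xK rx] := @join_rank_onto q.*2; first by lia.
apply/imsetP; exists x => //; rewrite /join_color (negPf xK) rx doubleK.
by congr inr; apply: val_inj; rewrite /= inordK; lia.
Qed.

Hypothesis k_gt1 : 1 < k.

Lemma join_rank_copy x y :
  join_rank y = (join_rank x).+1 -> x.1 != y.1.
Proof.
move=> rE; apply/eqP => e; have := join_rank_mod y.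
rewrite rE -e -join_rank_mod -addn1 -[X in _ = X %[mod _]]addn0 => /eqP.
by rewrite eqn_modDl mod0n modn_small.
Qed.

(** This is what makes the pairs universal: whatever vertex [z] is given, some
    vertex of the class lies in another copy than [z], hence is adjacent to it. *)
Lemma join_color_two_copies x : x.2 \notin K ->
  exists2 y, join_color y = join_color x & x.1 != y.1.
Proof.
move=> xK; have := join_rank_lt xK; set r := join_rank x => rlt.
have [last_odd|pair_ok] := boolP (odd r || (r.+1 == k * #|~: K|)).
  (* A last rank that is even is positive too, because [k > 1] leaves at least
     two vertices outside the copies of [K]. *)
  have r0 : 0 < r.
    rewrite lt0n; apply: contraTneq last_odd => -> /=.
    by rewrite eq_sym muln_eq1; lia.
  have [|y yK ry] := @join_rank_onto r.-1; first by lia.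
  exists y; last by rewrite eq_sym join_rank_copy // ry prednK.
  by apply: join_color_rank => //; rewrite ry -/r; lia.
have [|y yK ry] := @join_rank_onto r.+1; first by lia.
exists y; last by rewrite join_rank_copy.
by apply: join_color_rank => //; rewrite ry -/r; lia.
Qed.

Lemma join_color_adjacent x y : clique K -> join_color x != join_color y ->
  exists u v : join_copies G k,
    [/\ edge u v, join_color u = join_color x & join_color v = join_color y].
Proof.
move=> /cliqueP cK xy; have [e1|n1] := eqVneq x.1 y.1; last first.
  by exists x, y; split=> //=; rewrite /join_edge n1.
have [xK|xK] := boolP (x.2 \in K); last first.
  have [z zx n1] := join_color_two_copies xK.
  by exists z, y; split=> //=; rewrite /join_edge -e1 eq_sym n1.
have [yK|yK] := boolP (y.2 \in K); last first.
  have [z zy n1] := join_color_two_copies yK.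
  by exists x, z; split=> //=; rewrite /join_edge e1 n1.
exists x, y; split=> //=; rewrite /join_edge cK ?orbT //.
apply: contraNneq xy => e2.
by rewrite [x]surjective_pairing e1 e2 -surjective_pairing.
Qed.

End Coloring.

Lemma Psi_join : 1 < k ->
  Psi (join_copies G k) = (k * (clique_number G + #|G|))./2.
Proof.
move=> k_gt1; apply/eqP; rewrite eqn_leq; apply/andP; split.
  have := double_Psi_leq (join_copies G k); have := clique_number_join.
  by rewrite card_prod card_ord mulnDr; lia.
have [K cK <-] := clique_number_attained G.
have adj x y := @join_color_adjacent K k_gt1 x y cK.
suff -> : (k * (#|K| + #|G|))./2 = k * #|K| + (k * #|~: K|)./2.
  exact: leq_trans (join_color_count K) (Psi_image adj).
rewrite -(cardsC K) addnA mulnDr halfD.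
have -> : k * (#|K| + #|K|) = (k * #|K|).*2 by rewrite mulnDr addnn.
by rewrite odd_double doubleK.
Qed.

End Join.

(** * The characterization of weak criticality *)

Theorem theorem5p6 (G : sgraph) (k : nat)
    (hk : 3 <= k) (hodd : odd (k * (clique_number G + #|G|))) :
  ~ critical G /\
  (weakly_critical G <-> k * Psi G + k./2 = Psi (join_copies G k)).
Proof.
have [k_odd G_odd] : odd k /\ odd (clique_number G + #|G|).
  by apply/andP; rewrite -oddM.
split; first exact: not_critical.
rewrite weakly_criticalP // Psi_join; last by lia.
(* With [N := clique_number G + #|G|], both [k] and [k * N] are odd, so the
   equation reads [k * (2 * Psi G) + (k - 1) = k * N - 1]. *)
have k_gt0 : 0 < k by lia.
rewrite (rwP eqP) -(eqn_pmul2l k_gt0) mulnDr muln1 mulnCA -(rwP eqP).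
by set N := k * (_ + _) in hodd *; set P := k * Psi G; lia.
Qed.
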